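(* Let $F\colon\mathbf{Set}\to\mathbf{Set}$ be a functor with a final coalgebra $z\colon Z\to FZ$, and let $\overline{F}\colon\mathbf{PMet}\to\mathbf{PMet}$ be a lifting of $F$. Let $d_z=\inf\{d\mid d\text{ pseudometric on }Z,\ d^F\circ(z\times z)\le d\}$. If $\overline{F}$ preserves metrics and the final chain of $F$ converges, then $d_z$ is a metric, i.e. $d_z(w,w')=0\iff w=w'$ for all $w,w'\in Z$. Consequently, for every $F$-coalgebra $c\colon X\to FX$ and all $x,x'\in X$ we have $[\![x]\!]_c=[\![x']\!]_c \iff \mathrm{bd}_c(x,x')=0$, where $\mathrm{bd}_c(x,x')=d_z([\![x]\!]_c,[\![x']\!]_c)$.
   Context: Fix $\top\in(0,\infty]$. A ($\top$-)pseudometric on a set $X$ is $d\colon X\times X\to[0,\top]$ with $d(x,x)=0$, symmetry and the triangle inequality (with $a+\infty=\infty$); it is a metric if moreover $d(x,y)=0$ implies $x=y$. $\mathbf{PMet}$ is the category of $\top$-pseudometric spaces and nonexpansive maps ($d_Y(f(x),f(x'))\le d_X(x,x')$), with forgetful functor $U$ to $\mathbf{Set}$. Pseudometrics on a set are ordered pointwise and form a complete lattice; infima are taken in this lattice. A lifting of $F$ is a functor $\overline{F}$ on $\mathbf{PMet}$ with $U\circ\overline{F}=F\circ U$; write $\overline{F}(X,d)=(FX,d^F)$. $\overline{F}$ preserves metrics if $d^F$ is a metric whenever $d$ is. For a coalgebra $c$, $[\![\cdot]\!]_c$ is the unique coalgebra homomorphism into $z$. The final chain of $F$: objects $W_0=\mathbf{1}$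 (a one-element set), $W_{i+1}=FW_i$, $W_j=\lim_{i<j}W_i$ for limit ordinals $j$; maps $p_{i,j}\colon W_j\to W_i$ ($i\le j$) with $p_{0,i}$ the unique map to $\mathbf 1$, $p_{i,i}=\mathrm{id}$, $p_{i+1,j+1}=Fp_{i,j}$, and for limit $j$ the $p_{i,j}$ are the limit cone; it converges if $p_{\lambda,\lambda+1}$ is a bijection for some ordinal $\lambda$. *)

(* Defs.v *)
From HB Require Import structures.
From mathcomp Require Import all_boot all_order all_algebra.
From mathcomp Require Import all_classical all_reals wochoice ereal.

Set Implicit Arguments.
Unset Strict Implicit.
Unset Printing Implicit Defensive.

Import Order.TTheory GRing.Theory Num.Theory.
Local Open Scope classical_set_scope.
Local Open Scope ereal_scope.

(** The category of sets is the category of types of one fixed universe and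
    functions (up to extensional, hence Leibniz, equality).  The indices of the
    final chain live in the same universe. *)
Definition SET := Type.

Record setFunctor := SetFunctor {
  fob :> SET -> SET;
  fmap : forall X Y : SET, (X -> Y) -> fob X -> fob Y;
  fmap_id : forall X : SET, fmap (@id X) = id;
  fmap_comp : forall (X Y V : SET) (g : Y -> V) (f : X -> Y),
    fmap (g \o f) = fmap g \o fmap f }.

Arguments fmap F [X Y] f _ : rename.

Definition coalg_hom (F : setFunctor) (X Y : SET)
  (c : X -> F X) (e : Y -> F Y) (h : X -> Y) := e \o h = fmap F h \o c.

Record finalCoalgebra (F : setFunctor) := FinalCoalgebra {
  fcarrier : SET;
  fcoalg : fcarrier -> F fcarrier;
  semantics : forall X : SET, (X -> F X) -> X -> fcarrier;
  semantics_hom : forall (X : SET) (c : X -> F X),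
    coalg_hom c fcoalg (semantics c);
  semantics_unique : forall (X : SET) (c : X -> F X) (h : X -> fcarrier),
    coalg_hom c fcoalg h -> h = semantics c }.

(** Final chain.  An ordinal is represented by an element of a well-ordered
    type [(I, le)]: the one it corresponds to is the order type of the set of
    its strict predecessors. *)
Section Ordinals.
Variables (I : SET) (le : rel I).

Definition strictly_below (i j : I) : Prop := le i j /\ i <> j.

Definition is_zero (i : I) : Prop := forall k, le i k.

Definition is_succ (i j : I) : Prop :=
  strictly_below i j /\ forall k, strictly_below i k -> le j k.

Definition is_limit (j : I) : Prop :=
  ~ is_zero j /\ forall i, ~ is_succ i j.

Lemma strictly_belowW i j : strictly_below i j -> le i j.
Proof. by case. Qed.

Lemma is_succW i j : is_succ i j -> le i j.
Proof. by case=> /strictly_belowW. Qed.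

End Ordinals.

(** The initial segment, indexed by [(I, le)], of the final chain.  Since limits
    are only determined up to isomorphism, [W_(i+1) = F W_i] is rendered by a
    chosen bijection [chain_step], along which [p_(i+1,j+1)] is [F p_(i,j)]. *)
Record finalChain (F : setFunctor) (I : SET) (le : rel I) := FinalChain {
  chain_ob : I -> SET;
  chain_map : forall i j, le i j -> chain_ob j -> chain_ob i;
  chain_map_id : forall i (h : le i i), chain_map h = id;
  chain_map_comp : forall i j k (hij : le i j) (hjk : le j k) (hik : le i k),
    chain_map hij \o chain_map hjk = chain_map hik;
  chain_zero : forall i, is_zero le i ->
    exists x : chain_ob i, forall y : chain_ob i, y = x;
  chain_step : forall i j, is_succ le i j -> chain_ob j -> F (chain_ob i);
  chain_step_bij : forall i j (s : is_succ le i j), bijective (chain_step s);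
  chain_step_map : forall i i' j j' (s : is_succ le i i') (t : is_succ le j j')
      (h : le i j) (h' : le i' j'),
    chain_step s \o chain_map h' = fmap F (chain_map h) \o chain_step t;
  chain_limit : forall j, is_limit le j ->
    forall (V : SET) (f : forall i, strictly_below le i j -> V -> chain_ob i),
    (forall i k (hik : le i k)
            (hi : strictly_below le i j) (hk : strictly_below le k j),
       chain_map hik \o f k hk = f i hi) ->
    exists! u : V -> chain_ob j, forall i (hi : strictly_below le i j),
      chain_map (strictly_belowW hi) \o u = f i hi }.

Arguments chain_map [F I le] f [i j] _ _ : rename.

Definition final_chain_converges (F : setFunctor) : Prop :=
  exists (I : SET) (le : rel I) (W : finalChain F le)
         (l l' : I) (s : is_succ le l l'),
    well_order le /\ bijective (chain_map W (is_succW s)).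

Section PseudoMetrics.
Context {R : realType} (T : \bar R).

Record pmetric (X : SET) := PMetric {
  pdist :> X -> X -> \bar R;
  pdist_ge0 : forall x y, 0 <= pdist x y;
  pdist_leT : forall x y, pdist x y <= T;
  pdist_refl : forall x, pdist x x = 0;
  pdist_sym : forall x y, pdist x y = pdist y x;
  pdist_triangle : forall x y z, pdist x z <= pdist x y + pdist y z }.

Definition is_metric (X : SET) (d : pmetric X) : Prop :=
  forall x y, d x y = 0 -> x = y.

Definition pm_le (X : SET) (d e : pmetric X) : Prop :=
  forall x y, d x y <= e x y.

Definition pm_lower_bounds (X : SET) (S : set (pmetric X)) : set (pmetric X) :=
  [set e | forall d, S d -> pm_le e d].

(** The infimum in the lattice of pseudometrics: the pointwise infimum need not
    satisfy the triangle inequality, but the pointwise supremum of the lower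
    bounds does, and it is the greatest one ([pm_infP]). *)
Definition pm_inf_dist (X : SET) (S : set (pmetric X)) (x y : X) : \bar R :=
  ereal_sup [set e x y | e in pm_lower_bounds S].

Section Inf.
Hypothesis T_gt0 : 0 < T.
Variables (X : SET) (S : set (pmetric X)).

Definition pm_zero : pmetric X.
Proof.
by exists (fun _ _ => 0) => // *; [exact: ltW | rewrite adde0].
Defined.

Let pm_zero_lb : pm_lower_bounds S pm_zero.
Proof. by move=> d _ x y; exact: pdist_ge0. Qed.

Let inf_ge0 x y : 0 <= pm_inf_dist S x y.
Proof. by apply: ereal_sup_ubound; exists pm_zero. Qed.

Let inf_leT x y : pm_inf_dist S x y <= T.
Proof. by apply: ge_ereal_sup => _ [e _ <-]; exact: pdist_leT. Qed.

Let inf_refl x : pm_inf_dist S x x = 0.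
Proof.
apply/eqP; rewrite eq_le inf_ge0 andbT.
by apply: ge_ereal_sup => _ [e _ <-]; rewrite pdist_refl.
Qed.

Let inf_sym x y : pm_inf_dist S x y = pm_inf_dist S y x.
Proof.
by congr ereal_sup; apply/seteqP; split=> _ [e eS <-];
  exists e => //; exact: pdist_sym.
Qed.

Let inf_triangle x y z :
  pm_inf_dist S x z <= pm_inf_dist S x y + pm_inf_dist S y z.
Proof.
apply: ge_ereal_sup => _ [e eS <-].
apply: (le_trans (pdist_triangle e x y z)).
by apply: leeD; apply: ereal_sup_ubound; exists e.
Qed.

Definition pm_inf : pmetric X :=
  PMetric inf_ge0 inf_leT inf_refl inf_sym inf_triangle.

Lemma pm_infP : pm_lower_bounds S pm_inf /\
  forall e, pm_lower_bounds S e -> pm_le e pm_inf.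
Proof.
split=> [d Sd x y | e eS x y]; last by apply: ereal_sup_ubound; exists e.
by apply: ge_ereal_sup => _ [e eS <-]; exact: eS.
Qed.

End Inf.

Record pmet := PMet { pcarrier : SET; pmetr : pmetric pcarrier }.

Record pmet_hom (A B : pmet) := PMetHom {
  phom :> pcarrier A -> pcarrier B;
  phom_nonexpansive : forall x y, pmetr B (phom x) (phom y) <= pmetr A x y }.

Definition pmet_id (A : pmet) : pmet_hom A A.
Proof. by exists id. Defined.

Definition pmet_comp (A B C : pmet) (g : pmet_hom B C) (f : pmet_hom A B) :
  pmet_hom A C.
Proof.
exists (g \o f) => x y.
exact: (le_trans (phom_nonexpansive g _ _) (phom_nonexpansive f _ _)).
Defined.

(** Liftings [Fbar] of [F].  The equation [U \o Fbar = F \o U] holds on objects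
    by construction, as [Fbar (X, d) = (F X, lift_pm d)], and on morphisms by
    [lift_mapE]. *)
Definition lift_pmet (F : setFunctor)
    (lift_pm : forall X : SET, pmetric X -> pmetric (F X)) (A : pmet) : pmet :=
  PMet (lift_pm _ (pmetr A)).

Record lifting (F : setFunctor) := Lifting {
  lift_pm : forall X : SET, pmetric X -> pmetric (F X);
  lift_map : forall A B : pmet,
    pmet_hom A B -> pmet_hom (lift_pmet lift_pm A) (lift_pmet lift_pm B);
  lift_map_id : forall A, lift_map (pmet_id A) = pmet_id (lift_pmet lift_pm A);
  lift_map_comp : forall A B C (g : pmet_hom B C) (f : pmet_hom A B),
    lift_map (pmet_comp g f) = pmet_comp (lift_map g) (lift_map f);
  lift_mapE : forall A B (f : pmet_hom A B), lift_map f = fmap F f :> (_ -> _) }.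

Definition preserves_metrics (F : setFunctor) (L : lifting F) : Prop :=
  forall (X : SET) (d : pmetric X), is_metric d -> is_metric (lift_pm L d).

Section BehaviouralDistance.
Hypothesis T_gt0 : 0 < T.
Variables (F : setFunctor) (Z : finalCoalgebra F) (L : lifting F).

Definition final_dist : pmetric (fcarrier Z) :=
  pm_inf T_gt0 [set d : pmetric (fcarrier Z) |
    forall w w', lift_pm L d (fcoalg w) (fcoalg w') <= d w w'].

Definition behavioural_dist (X : SET) (c : X -> F X) (x x' : X) : \bar R :=
  final_dist (semantics Z c x) (semantics Z c x').

End BehaviouralDistance.
End PseudoMetrics.

(* Main.v *)
(** By Knaster-Tarski, the infimum [final_dist] itself makes the final coalgebra
    [z : Z -> F Z] nonexpansive.  Let [q : Z -> Q] be the metric quotient, which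
    identifies points at distance 0.  Then [F q \o z] is nonexpansive into
    [F Q], a metric space because the lifting preserves metrics; hence it also
    identifies points at distance 0.  So [Q] carries a coalgebra structure for
    which [q] is a homomorphism, and by finality [q] has a left inverse. *)
Require Import Defs.
From mathcomp Require Import all_boot all_order all_algebra.
From mathcomp Require Import all_classical all_reals ereal.

Set Implicit Arguments.
Unset Strict Implicit.
Unset Printing Implicit Defensive.

Local Open Scope ereal_scope.
Import Order.TTheory.

Section Pseudometrics.
Context {R : realType} {T : \bar R}.

Definition pm_pullback (X Y : SET) (f : X -> Y) (d : pmetric T Y) :
  pmetric T X.
Proof.
exists (fun x y => d (f x) (f y)) => *.
- exact: pdist_ge0.
- exact: pdist_leT.
- exact: pdist_refl.
- exact: pdist_sym.
- exact: pdist_triangle.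
Defined.

Lemma pdist_eq0_congr (X : SET) (d : pmetric T X) (x y z : X) :
  d x y = 0 -> d x z = d y z.
Proof.
move=> dxy; apply/eqP; rewrite eq_le; apply/andP; split.
  by apply: le_trans (pdist_triangle d x y z) _; rewrite dxy add0e.
apply: le_trans (pdist_triangle d y x z) _.
by rewrite (pdist_sym d y x) dxy add0e.
Qed.

Section Representative.
Context {X : SET} (d : pmetric T X).

Let ex_dist0 (x : X) : exists y, d x y = 0.
Proof. by exists x; exact: pdist_refl. Qed.

Definition dist0_repr (x : X) : X := projT1 (cid (ex_dist0 x)).

Lemma dist0_reprP x : d x (dist0_repr x) = 0.
Proof. exact: (projT2 (cid (ex_dist0 x))). Qed.

(** Points at distance 0 have the same zero-distance predicate, and [cid] picks equal witnesses from
    equal predicates. *)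
Lemma dist0_repr_eq x y : d x y = 0 -> dist0_repr x = dist0_repr y.
Proof.
move=> dxy; rewrite /dist0_repr.
have E : (fun u => d x u = 0) = (fun u => d y u = 0).
  by apply/funext => u; rewrite (pdist_eq0_congr _ dxy).
move: (ex_dist0 x) (ex_dist0 y); rewrite E => h h'.
by rewrite (Prop_irrelevance h h').
Qed.

(** Classes are encoded by their chosen representatives, so the quotient metric is a restriction of
    [d]. *)
Definition metric_quotient : SET := {x : X | dist0_repr x = x}.

Definition to_quotient (x : X) : metric_quotient :=
  exist _ (dist0_repr x) (esym (dist0_repr_eq (dist0_reprP x))).

Definition quotient_pm : pmetric T metric_quotient := pm_pullback sval d.

Lemma quotient_pm_metric : is_metric quotient_pm.
Proof.
by move=> [x hx] [y hy] /= /dist0_repr_eq; rewrite hx hy; exact: eq_exist.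
Qed.

(** Moving a point to its representative changes no distance, so equality even holds. *)
Lemma to_quotient_nonexpansive (x y : X) :
  quotient_pm (to_quotient x) (to_quotient y) <= d x y.
Proof.
rewrite /= -(pdist_eq0_congr _ (dist0_reprP x)).
by rewrite pdist_sym -(pdist_eq0_congr _ (dist0_reprP y)) pdist_sym.
Qed.

End Representative.

Section Lifting.
Context {F : setFunctor} (L : lifting T F).

Lemma fmap_nonexpansive (X Y : SET) (d : pmetric T X) (e : pmetric T Y)
    (f : X -> Y) : (forall x y, e (f x) (f y) <= d x y) ->
  forall u v, lift_pm L e (Defs.fmap F f u) (Defs.fmap F f v) <= lift_pm L d u v.
Proof.
move=> fne u v.
have := phom_nonexpansive (lift_map L (@PMetHom _ _ (PMet d) (PMet e) f fne)) u v.
by rewrite lift_mapE.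
Qed.

(** [pm_le d e] says that [id] is nonexpansive from [(X, e)] to [(X, d)]. *)
Lemma lift_pm_mono (X : SET) (d e : pmetric T X) :
  pm_le d e -> pm_le (lift_pm L d) (lift_pm L e).
Proof. by move=> de u v; have := fmap_nonexpansive de u v; rewrite Defs.fmap_id. Qed.

Lemma fcoalg_nonexpansive (T_gt0 : 0 < T) (Z : finalCoalgebra F)
    (w w' : fcarrier Z) :
  lift_pm L (final_dist T_gt0 Z L) (fcoalg w) (fcoalg w')
    <= final_dist T_gt0 Z L w w'.
Proof.
have [lb glb] := pm_infP T_gt0 [set d : pmetric T (fcarrier Z) |
  forall w w', lift_pm L d (fcoalg w) (fcoalg w') <= d w w']%classic.
(* By monotonicity, this pullback lies below the pullback of [lift_pm L d], hence below [d], for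
   each [d] in the set. *)
apply: (glb (pm_pullback (@fcoalg _ Z) (lift_pm L (final_dist T_gt0 Z L)))).
move=> d dz x y; apply: le_trans (dz x y).
exact: lift_pm_mono (lb d dz) _ _.
Qed.

Lemma fcoalg_nonexpansive_metric (Z : finalCoalgebra F)
    (d : pmetric T (fcarrier Z)) : preserves_metrics L ->
  (forall w w', lift_pm L d (fcoalg w) (fcoalg w') <= d w w') -> is_metric d.
Proof.
move=> Lmetric dz.
pose q := to_quotient d; pose Fqz w := Defs.fmap F q (fcoalg w).
have Fqz_eq w w' : d w w' = 0 -> Fqz w = Fqz w'.
  move=> dww'; apply: (Lmetric _ _ (@quotient_pm_metric _ d)).
  apply/eqP; rewrite eq_le pdist_ge0 andbT -dww'; apply: le_trans (dz w w').
  exact/fmap_nonexpansive/to_quotient_nonexpansive.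
pose c := Fqz \o sval : metric_quotient d -> F (metric_quotient d).
(* [c (q w)] is [Fqz] at the representative of [w], which is at distance 0 from [w]. *)
have q_hom : coalg_hom (@fcoalg _ Z) c q.
  by apply/funext => w /=; exact/esym/Fqz_eq/dist0_reprP.
(* Both sides are coalgebra endomorphisms of the final coalgebra. *)
have rq_id : semantics Z c \o q = id.
  have id_hom : coalg_hom (@fcoalg _ Z) (@fcoalg _ Z) id.
    by rewrite /coalg_hom Defs.fmap_id.
  rewrite (semantics_unique id_hom); apply: semantics_unique.
  have r_hom := semantics_hom Z c; rewrite /coalg_hom in q_hom r_hom *.
  by rewrite compA r_hom -compA q_hom compA Defs.fmap_comp.
move=> w w' dww'.
have qE : q w = q w' by apply: eq_exist; exact: dist0_repr_eq.
by have := congr1 (semantics Z c) qE; rewrite -!/((_ \o q) _) rq_id.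
Qed.

End Lifting.
End Pseudometrics.

Theorem theorem6p10 (R : realType) (T : \bar R) (T_gt0 : 0 < T)
    (F : setFunctor) (Z : finalCoalgebra F) (L : lifting T F) :
  preserves_metrics L -> final_chain_converges F ->
  is_metric (final_dist T_gt0 Z L) /\
  (forall w w' : fcarrier Z, final_dist T_gt0 Z L w w' = 0 <-> w = w') /\
  (forall (X : SET) (c : X -> F X) (x x' : X),
     semantics Z c x = semantics Z c x' <->
     behavioural_dist T_gt0 Z L c x x' = 0).
Proof.
move=> Lmetric _.
have dP : is_metric (final_dist T_gt0 Z L).
  apply: (fcoalg_nonexpansive_metric Lmetric) => w w'.
  exact: fcoalg_nonexpansive.
have d0 w w' : final_dist T_gt0 Z L w w' = 0 <-> w = w'.
  by split=> [/dP | ->]; [|exact: pdist_refl].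
by split=> //; split=> // X c x x'; split=> ?; exact/d0.
Qed.
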